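(* Let $\mathbb{F}$ be a field with $\mathrm{char}(\mathbb{F})\neq 2,3$. Every ideal of $\hat{\mathcal{H}}$ is principal.
   Context: Notation: $\mathbb{N}=\{1,2,3,\dots\}$, $3\mathbb{N}=\{3,6,9,\dots\}$; for $r\in\mathbb{Z}$, $\bar r=r+3\mathbb{Z}\in\mathbb{Z}_3$. The algebra $\hat{\mathcal{H}}$ is the commutative $\mathbb{F}$-algebra with basis $\{a_i:i\in\mathbb{Z}\}\cup\{s_j:j\in\mathbb{N}\}\cup\{p_{\bar r,k}:\bar r\in\{\bar1,\bar2\},\ k\in 3\mathbb{N}\}$, where $s_0=0$, $p_{\bar r,j}=0$ for all $\bar r$ whenever $j\notin 3\mathbb{N}$, $p_{\bar 0,j}=-p_{\bar1,j}-p_{\bar2,j}$, $z_{\bar r,j}=p_{\bar r+\bar1,j}-p_{\bar r-\bar1,j}$, and for $i,i'\in\mathbb{Z}$, $j,l\in\mathbb{N}$, $h,k\in3\mathbb{N}$, $\bar r,\bar t\in\mathbb{Z}_3$: (H1) $a_ia_{i'}=\tfrac12(a_i+a_{i'})+s_{|i-i'|}+z_{\bar\imath,|i-i'|}$; (H2) $a_is_j=-\tfrac34a_i+\tfrac38(a_{i-j}+a_{i+j})+\tfrac32 s_j-z_{\bar\imath,j}$; (H3) $a_ip_{\bar r,k}=\tfrac32p_{\bar r,k}-p_{-(\bar\imath+\bar r),k}$; (H4) $s_js_l=\tfrac34(s_j+s_l)-\tfrac38(s_{|j-l|}+s_{j+l})$; (H5) $s_jp_{\bar r,k}=\tfrac34(p_{\bar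 r,j}+p_{\bar r,k})-\tfrac38(p_{\bar r,|j-k|}+p_{\bar r,j+k})$; (H6) $p_{\bar r,h}p_{\bar t,k}=\tfrac14(z_{-(\bar r+\bar t),h}+z_{-(\bar r+\bar t),k})-\tfrac18(z_{-(\bar r+\bar t),|h-k|}+z_{-(\bar r+\bar t),h+k})$. *)

(* Defs.v *)
From HB Require Import structures.
From mathcomp Require Import all_boot all_order all_algebra.
Set Implicit Arguments.
Unset Strict Implicit.
Unset Printing Implicit Defensive.
Import Order.TTheory GRing.Theory Num.Theory.
Local Open Scope ring_scope.

Definition ibar (i : int) : 'Z_3 := i%:~R.

Definition is_ideal (F : fieldType) (V : lmodType F) (mul : V -> V -> V)
  (I : V -> Prop) : Prop :=
  [/\ I 0,
      (forall (c : F) x y, I x -> I y -> I (c *: x + y)) &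
      (forall x y, I y -> I (mul x y) /\ I (mul y x))].

Definition ideal_gen (F : fieldType) (V : lmodType F) (mul : V -> V -> V)
  (x : V) : V -> Prop :=
  fun v => forall J, is_ideal mul J -> J x -> J v.

Definition is_principal (F : fieldType) (V : lmodType F) (mul : V -> V -> V)
  (I : V -> Prop) : Prop :=
  exists x, forall v, I v <-> ideal_gen mul x v.

(* Index set of the basis:
   inl i            ~ a_i        (i in Z)
   inr (inl j)      ~ s_{j+1}    (j+1 in N = {1,2,...})
   inr (inr (b,k))  ~ p_{1,3(k+1)} if b, p_{2,3(k+1)} otherwise  (3(k+1) in 3N) *)
Definition HIdx := (int + (nat + (bool * nat)))%type.

Definition hbasis (F : fieldType) (V : lmodType F)
  (a : int -> V) (s : nat -> V) (p : 'Z_3 -> nat -> V) (b : HIdx) : V :=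
  match b with
  | inl i => a i
  | inr (inl j) => s j.+1
  | inr (inr (bb, k)) => p (if bb then 1 else 2%:R) (3 * k.+1)%N
  end.

Definition is_basis (F : fieldType) (V : lmodType F) (e : HIdx -> V) : Prop :=
  (forall (l : seq HIdx) (c : HIdx -> F), uniq l ->
      \sum_(b <- l) c b *: e b = 0 -> forall b, b \in l -> c b = 0) /\
  (forall v : V, exists (l : seq HIdx) (c : HIdx -> F),
      v = \sum_(b <- l) c b *: e b).

Definition zz (F : fieldType) (V : lmodType F) (p : 'Z_3 -> nat -> V)
  (r : 'Z_3) (j : nat) : V := p (r + 1) j - p (r - 1) j.

(* Main.v *)
(* Write A, S, P for the spans of the a_i, s_j and p_{r,k}.  Identify A with F[t,1/t] by
   a_i = t^i and S with the inversion-invariant Laurent polynomials vanishing at 1 by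
   s_j = 3/4 (1 - (t^j + t^-j)/2); then modulo P the products are given by multiplication,
   augmentation and symmetrisation of Laurent polynomials.

   An ideal containing an element of nonzero weight is everything: a polynomial in the
   multiplication by a_k projects onto the 1-eigenspace, which is spanned by a_k.

   Let I have weight zero.  Modulo P, both the A-projection I_A of I and N = I :&: A turn
   out to be ideals of F[t,1/t] with (t - 1) I_A contained in N, and I is determined modulo P
   by I_A and N.  As I_A = (g), any x in I with A-part g (taken without S-part if g is in N)
   generates I modulo P.

   I :&: P is Q (x) W with W the 2-dimensional representation of Sym(3) and Q a cyclic module
   over F[s_3].  Some operator R, built from the multiplications by s_1, s_2 and a_0, maps I
   to the (5/2)-eigenspace of a_0 in I :&: P and is multiplication by 4 on that eigenspace.
   Hence x can be corrected inside I :&: P so that R x is a prescribed generator of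
   I :&: P, and then x generates I. *)

Require Import Defs.
From HB Require Import structures.
From mathcomp Require Import all_boot all_order all_algebra ring zify.
From Stdlib Require Import ClassicalEpsilon.
Import Order.TTheory GRing.Theory Num.Theory.
Local Open Scope ring_scope.

Set Implicit Arguments.
Unset Strict Implicit.

(** * Linear maps prescribed on the basis *)

Section LinearExtension.

Context (F : fieldType) (V : lmodType F) (e : HIdx -> V) (hbas : is_basis e).

(** Indices may repeat in [L], so that adding combinations is concatenating lists. *)
Definition lcomb (U : lmodType F) (g : HIdx -> U) (L : seq (HIdx * F)) : U :=
  \sum_(x <- L) x.2 *: g x.1.

Lemma lcomb_collect (U : lmodType F) (g : HIdx -> U) L :
  lcomb g L = \sum_(b <- undup (map fst L)) (\sum_(x <- L | x.1 == b) x.2) *: g b.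
Proof.
transitivity (\sum_(b <- undup (map fst L)) \sum_(x <- L | x.1 == b) x.2 *: g x.1).
  rewrite (exchange_big_dep predT) //= /lcomb big_seq [RHS]big_seq.
  apply: eq_bigr => x xL; under eq_bigl do rewrite eq_sym.
  rewrite big_mkcond (bigD1_seq x.1) ?mem_undup ?map_f ?undup_uniq //= eqxx.
  by rewrite big1 ?addr0 // => b /negPf ->.
by apply: eq_bigr => b _; rewrite scaler_suml; apply: eq_bigr => x /eqP ->.
Qed.

(** Once repeated indices are merged, all coefficients vanish by independence of [e]. Hence [lext]
    does not depend on the chosen decomposition. *)
Lemma lcomb_eq0 (U : lmodType F) (g : HIdx -> U) L : lcomb e L = 0 -> lcomb g L = 0.
Proof.
rewrite !lcomb_collect => /(hbas.1 _ _ (undup_uniq _)) h.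
by rewrite big_seq big1 // => b /h ->; rewrite scale0r.
Qed.

Lemma lcomb_span v : exists L, v = lcomb e L.
Proof.
have [l [c ->]] := hbas.2 v.
by exists [seq (b, c b) | b <- l]; rewrite /lcomb big_map.
Qed.

Definition decomposition v : seq (HIdx * F) :=
  sval (constructive_indefinite_description _ (lcomb_span v)).

Lemma decompositionE v : lcomb e (decomposition v) = v.
Proof. by rewrite /decomposition; case: constructive_indefinite_description. Qed.

Definition lext (U : lmodType F) (g : HIdx -> U) (v : V) : U := lcomb g (decomposition v).

Lemma lext_lcomb (U : lmodType F) (g : HIdx -> U) L : lext g (lcomb e L) = lcomb g L.
Proof.
apply/eqP; rewrite -subr_eq0; apply/eqP.
pose L' := decomposition (lcomb e L) ++ [seq (x.1, - x.2) | x <- L].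
have E (W : lmodType F) (h : HIdx -> W) : lcomb h L' = lext h (lcomb e L) - lcomb h L.
  rewrite /lcomb big_cat big_map /= -sumrN; congr (_ + _).
  by apply: eq_bigr => x _; rewrite scaleNr.
by rewrite -E lcomb_eq0 // E /lext decompositionE subrr.
Qed.

Lemma lext_linear (U : lmodType F) (g : HIdx -> U) : linear (lext g).
Proof.
move=> c x y; pose L := [seq (i.1, c * i.2) | i <- decomposition x] ++ decomposition y.
have E (W : lmodType F) (h : HIdx -> W) : lcomb h L = c *: lext h x + lext h y.
  rewrite /lcomb big_cat big_map /= scaler_sumr; congr (_ + _).
  by apply: eq_bigr => i _; rewrite scalerA.
by rewrite -E -lext_lcomb E /lext !decompositionE.
Qed.

HB.instance Definition _ (U : lmodType F) (g : HIdx -> U) :=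
  GRing.isLinear.Build F V U *:%R (lext g) (lext_linear g).

Lemma lext_basis (U : lmodType F) (g : HIdx -> U) b : lext g (e b) = g b.
Proof.
have -> : e b = lcomb e [:: (b, 1)] by rewrite /lcomb big_seq1 scale1r.
by rewrite lext_lcomb /lcomb big_seq1 scale1r.
Qed.

Lemma span_ind (P : V -> Prop) : P 0 -> (forall c x y, P x -> P y -> P (c *: x + y)) ->
  (forall b, P (e b)) -> forall v, P v.
Proof.
move=> P0 Plin Pe v; rewrite -(decompositionE v) /lcomb.
by apply: big_ind => // [x y Px Py|x _]; [rewrite -[x]scale1r|rewrite -[_ *: _]addr0]; apply: Plin.
Qed.

Lemma linear_ext (U : lmodType F) (f g : V -> U) : linear f -> linear g ->
  (forall b, f (e b) = g (e b)) -> f =1 g.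
Proof.
move=> fl gl fg; apply: span_ind => // [|c x y fx fy]; last by rewrite fl gl fx fy.
by have := fl (-1) 0 0; have := gl (-1) 0 0; rewrite !scaleN1r !addNr => -> ->.
Qed.

Definition coord b : V -> F^o := lext (fun b' => (b' == b)%:R).

Lemma coord_linear b : linear (coord b).
Proof. exact: lext_linear. Qed.

HB.instance Definition _ b := GRing.isLinear.Build F V F^o *:%R (coord b) (coord_linear b).

Lemma coordD b x y : coord b (x + y) = coord b x + coord b y.
Proof. exact: linearD. Qed.

Lemma coordN b x : coord b (- x) = - coord b x.
Proof. exact: linearN. Qed.

Lemma coordZ b c x : coord b (c *: x) = c * coord b x.
Proof. exact: linearZ. Qed.

Lemma coord0 b : coord b 0 = 0.
Proof. exact: linear0. Qed.

Lemma coord_inj x y : (forall b, coord b x = coord b y) -> x = y.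
Proof.
move=> xy; apply/eqP; rewrite -subr_eq0; apply/eqP.
have : forall b, coord b (x - y) = 0 by move=> b; rewrite coordD coordN xy subrr.
move: (x - y) => v v0; rewrite -(decompositionE v) lcomb_collect big1 // => b _.
suff -> : \sum_(i <- decomposition v | i.1 == b) i.2 = coord b v by rewrite v0 scale0r.
rewrite /coord /lext /lcomb big_mkcond; apply: eq_bigr => i _.
by case: eqP => _; rewrite [RHS]mulr_natr.
Qed.

End LinearExtension.

(* A bundle without canonical instances: rewriting with [opZ] must not match
   [*:%R c] itself as an operator. *)
Record linop (F : fieldType) (V : lmodType F) :=
  Linop { linop_fun :> V -> V; linop_linear : linear linop_fun }.

Arguments linop_fun : simpl never.

Section LinOp.

Context (F : fieldType) (V : lmodType F) (f : linop V).

Lemma op0 : f 0 = 0.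
Proof. by have := linop_linear f (-1) 0 0; rewrite scaler0 addr0 scaleN1r addNr. Qed.

Lemma opD x y : f (x + y) = f x + f y.
Proof. by have := linop_linear f 1 x y; rewrite !scale1r. Qed.

Lemma opZ c x : f (c *: x) = c *: f x.
Proof. by have := linop_linear f c x 0; rewrite op0 !addr0. Qed.

Lemma opN x : f (- x) = - f x.
Proof. by rewrite -scaleN1r opZ scaleN1r. Qed.

Lemma op_sum (I : Type) (r : seq I) (E : I -> V) :
  f (\sum_(i <- r) E i) = \sum_(i <- r) f (E i).
Proof. by apply: (big_morph f); [exact: opD|exact: op0]. Qed.

End LinOp.

(** * Ideals of F[X], and polynomials as combinations of vectors *)

Section PolynomialCombinations.

Context (F : fieldType).

(** Euclidean division: a nonzero remainder modulo [g] of a member is a member of smaller degree. As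
    [J] is an arbitrary predicate, the cases are decided classically. *)
Lemma poly_submodule_principal (J : {poly F} -> Prop) :
  J 0 -> (forall c g h, J g -> J h -> J (c *: g + h)) -> (forall h, J h -> J (h * 'X)) ->
  exists g, J g /\ forall h, J h -> exists k, h = k * g.
Proof.
move=> J0 Jlin JX.
have JM k h : J h -> J (k * h).
  move=> Jh; elim/poly_ind: k => [|k c IH]; first by rewrite mul0r.
  rewrite mulrDl addrC mul_polyC; apply: Jlin => //.
  by rewrite -mulrA -commr_polyX mulrA; apply: JX.
have [n] : exists n, exists g, [/\ J g, g != 0 & (size g <= n)%N] \/ forall h, J h -> h = 0.
  have [[g [Jg g0]]|nz] := classic (exists g, J g /\ g != 0).
    by exists (size g), g; left.
  exists 0%N, 0; right=> h Jh; apply/eqP/negPn/negP => h0; apply: nz; by exists h.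
case=> g [[Jg g0 gn]|z]; last by exists 0; split=> // h /z ->; exists 0; rewrite mul0r.
elim: n g Jg g0 gn => [|n IH] g Jg g0 gn; first by rewrite leqn0 size_poly_eq0 (negPf g0) in gn.
have [[h [Jh hg]]|nz] := classic (exists h, J h /\ h %% g != 0).
  apply: (IH (h %% g)) => //; last by rewrite -ltnS (leq_trans _ gn) // ltn_modp.
  have -> : h %% g = (-1) *: ((h %/ g) * g) + h.
    by rewrite scaleN1r {3}(divp_eq h g) addrA addNr add0r.
  by apply: Jlin => //; apply: JM.
exists g; split=> // h Jh; exists (h %/ g); rewrite {1}(divp_eq h g).
suff -> : h %% g = 0 by rewrite addr0.
by apply/eqP/negPn/negP => h0; apply: nz; exists h.
Qed.

Context (V : lmodType F).
Implicit Types (w : nat -> V) (h : {poly F}).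

Definition pcomb w h : V := \sum_(i < size h) h`_i *: w i.

Lemma pcomb_wide n w h : (size h <= n)%N -> pcomb w h = \sum_(i < n) h`_i *: w i.
Proof.
move=> hn; rewrite /pcomb -!(big_mkord xpredT (fun i => h`_i *: w i)).
rewrite [RHS](@big_cat_nat _ _ _ (size h)) //=.
rewrite [X in _ + X]big_nat_cond [X in _ + X]big1 ?addr0 // => i /andP[/andP[hi _] _].
by rewrite nth_default ?scale0r.
Qed.

Lemma pcomb_linear w : linear (pcomb w).
Proof.
move=> c g h; pose n := maxn (size g) (size h).
rewrite !(@pcomb_wide n) ?leq_maxl ?leq_maxr //; last first.
  rewrite (leq_trans (size_polyD _ _)) // geq_max leq_maxr.
  by rewrite (leq_trans (size_scale_leq _ _)) // leq_maxl.
rewrite scaler_sumr -big_split; apply: eq_bigr => i _.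
by rewrite coefD coefZ scalerDl scalerA.
Qed.

HB.instance Definition _ w := GRing.isLinear.Build F {poly F} V *:%R (pcomb w) (pcomb_linear w).

Lemma pcombXn w n : pcomb w 'X^n = w n.
Proof.
rewrite /pcomb size_polyXn big_ord_recr /= coefXn eqxx scale1r big1 ?add0r // => i _.
by rewrite coefXn ltn_eqF ?scale0r // ltn_ord.
Qed.

Lemma pcombMX w h : pcomb w (h * 'X) = pcomb (w \o S) h.
Proof.
rewrite (@pcomb_wide (size h).+1); last first.
  by have [->|h0] := eqVneq h 0; rewrite ?mul0r ?size_poly0 // size_mulX.
rewrite big_ord_recl coefMX eqxx scale0r add0r; apply: eq_bigr => i _.
by rewrite coefMX.
Qed.

Lemma op_pcomb (f : linop V) w w' h :
  (forall i, f (w i) = w' i) -> f (pcomb w h) = pcomb w' h.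
Proof. by move=> fw; rewrite op_sum; apply: eq_bigr => i _; rewrite opZ fw. Qed.

End PolynomialCombinations.

(** Serves the scalars inverted below, whose only prime factors are 2 and 3. *)
Lemma natr_neq0_23 (F : fieldType) n : 2%N \notin [pchar F] -> 3%N \notin [pchar F] ->
  (0 < n)%N -> all (fun q => q \in [:: 2; 3]) (primes n) -> n%:R != 0 :> F.
Proof.
move=> h2 h3 n0 /allP np; rewrite natf_neq0_pchar; apply/pnatP => // q qp qn.
have : q \in primes n by rewrite mem_primes qp n0.
by move/np; rewrite !inE => /orP[] /eqP ->.
Qed.

(** * The algebra and its coordinate operators *)

Section Algebra.

Context (F : fieldType) (hF2 : 2%N \notin [pchar F]) (hF3 : 3%N \notin [pchar F])
  (V : lmodType F) (mul : V -> V -> V)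
  (mulC : forall x y, mul x y = mul y x)
  (mul_linl : forall (c : F) x y w, mul (c *: x + y) w = c *: mul x w + mul y w)
  (a : int -> V) (s : nat -> V) (p : 'Z_3 -> nat -> V)
  (hs0 : s 0%N = 0)
  (hp3N : forall r j, ~~ ((0 < j)%N && (3 %| j)%N) -> p r j = 0)
  (hp0 : forall j, p 0 j = - p 1 j - p 2%:R j)
  (hbas : is_basis (hbasis a s p))
  (H1 : forall i i' : int,
     mul (a i) (a i') = 2^-1 *: (a i + a i') + s (absz (i - i'))
                        + zz p (ibar i) (absz (i - i')))
  (H2 : forall (i : int) (j : nat), (0 < j)%N ->
     mul (a i) (s j) = - (3%:R / 4%:R) *: a i
                       + (3%:R / 8%:R) *: (a (i - j%:Z) + a (i + j%:Z))
                       + (3%:R / 2%:R) *: s j - zz p (ibar i) j)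
  (H3 : forall (i : int) (r : 'Z_3) (k : nat), (0 < k)%N -> (3 %| k)%N ->
     mul (a i) (p r k) = (3%:R / 2%:R) *: p r k - p (- (ibar i + r)) k)
  (H4 : forall j l : nat, (0 < j)%N -> (0 < l)%N ->
     mul (s j) (s l) = (3%:R / 4%:R) *: (s j + s l)
       - (3%:R / 8%:R) *: (s (absz (j%:Z - l%:Z)) + s (j + l)%N))
  (H5 : forall (j : nat) (r : 'Z_3) (k : nat), (0 < j)%N -> (0 < k)%N -> (3 %| k)%N ->
     mul (s j) (p r k) = (3%:R / 4%:R) *: (p r j + p r k)
       - (3%:R / 8%:R) *: (p r (absz (j%:Z - k%:Z)) + p r (j + k)%N)).

Let opE := (opD, opN, opZ, op0).
Let nz := fun n => @natr_neq0_23 F n hF2 hF3.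

(** Comparing coordinates reduces an identity of vectors to one in the field. *)
Ltac vring := apply: (@coord_inj _ _ _ hbas) => ?;
  rewrite ?(coordD, coordN, coordZ, coord0); field; rewrite ?nz //.

Lemma mul_linear u : linear (mul u).
Proof. by move=> c x y; rewrite mulC mul_linl !(mulC _ u). Qed.

Definition ad u : linop V := Linop (mul_linear u).

Lemma adE u v : ad u v = mul u v.
Proof. by []. Qed.

(** Only basis indices enter, so [opr_s] and [opr_p] ask that [fs] and [fp] obey the conventions for
    s_0, p_{0,j} and p_{r,j} with j outside 3N. *)
Definition opr (fa : int -> V) (fs : nat -> V) (fp : 'Z_3 -> nat -> V) : linop V :=
  Linop (lext_linear hbas (hbasis fa fs fp)).

Lemma Z3P (r : 'Z_3) : [\/ r = 0, r = 1 | r = 2%:R].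
Proof.
by case: r => -[|[|[|//]]] ?; [apply: Or31|apply: Or32|apply: Or33]; apply: val_inj.
Qed.

Lemma opr_a fa fs fp i : opr fa fs fp (a i) = fa i.
Proof. exact: (lext_basis hbas (hbasis fa fs fp) (inl i)). Qed.

Lemma opr_s fa fs fp j : fs 0%N = 0 -> opr fa fs fp (s j) = fs j.
Proof.
case: j => [->|j _]; first by rewrite hs0 op0.
exact: (lext_basis hbas (hbasis fa fs fp) (inr (inl j))).
Qed.

Lemma opr_p fa fs fp r j : (forall r j, ~~ ((0 < j)%N && (3 %| j)%N) -> fp r j = 0) ->
  (forall j, fp 0 j = - fp 1 j - fp 2%:R j) -> opr fa fs fp (p r j) = fp r j.
Proof.
move=> f3 f0; have [|jn] := boolP ((0 < j)%N && (3 %| j)%N); last first.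
  by rewrite f3 // hp3N // op0.
case: j => // j /andP[_ /dvdnP[[//|k] ->]]; rewrite mulnC.
have p1 : opr fa fs fp (p 1 _) = fp 1 _ :=
  lext_basis hbas (hbasis fa fs fp) (inr (inr (true, k))).
have p2 : opr fa fs fp (p 2%:R _) = fp 2%:R _ :=
  lext_basis hbas (hbasis fa fs fp) (inr (inr (false, k))).
by case: (Z3P r) => -> //; rewrite hp0 f0 !opE p1 p2.
Qed.

Lemma basis_ext (f g : V -> V) : linear f -> linear g -> (forall i, f (a i) = g (a i)) ->
  (forall j, (0 < j)%N -> f (s j) = g (s j)) ->
  (forall r k, (0 < k)%N -> (3 %| k)%N -> f (p r k) = g (p r k)) -> f =1 g.
Proof.
move=> fl gl fa fs fp; apply: (linear_ext hbas) => // -[i|[j|[r k]]] /=; rewrite ?fa ?fs //.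
by rewrite fp // dvdn_mulr.
Qed.

(* [T k] is multiplication by t^k on A and [rf] the inversion of t, both zero on S and P;
   [T 0] is thus the projection to A.  [iot] embeds S into A = F[t,1/t], and on weight zero
   [kap] is -3/4 times the symmetrisation A -> S. *)
Definition wt := opr (fun=> a 0) (fun=> 0) (fun _ _ => 0).
Definition T k := opr (fun i => a (i + k)) (fun=> 0) (fun _ _ => 0).
Definition rf := opr (fun i => a (- i)) (fun=> 0) (fun _ _ => 0).
Definition piS := opr (fun=> 0) s (fun _ _ => 0).
Definition piP := opr (fun=> 0) (fun=> 0) p.
Definition kap := opr (fun i => s (absz i)) (fun=> 0) (fun _ _ => 0).
Definition iot := opr (fun=> 0)
  (fun j => (3%:R / 4%:R) *: a 0 - (3%:R / 8%:R) *: (a j%:Z + a (- j%:Z))) (fun _ _ => 0).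

Let zz3 r j : ~~ ((0 < j)%N && (3 %| j)%N) -> zz p r j = 0.
Proof. by move=> jn; rewrite /zz !hp3N // subrr. Qed.

Lemma opr0p fa fs r j : opr fa fs (fun _ _ => 0) (p r j) = 0.
Proof. by rewrite opr_p // => ?; rewrite oppr0 addr0. Qed.

Lemma opr0z fa fs r j : opr fa fs (fun _ _ => 0) (zz p r j) = 0.
Proof. by rewrite !opE !opr0p subrr. Qed.

Lemma wtE : (forall i, wt (a i) = a 0) * (forall j, wt (s j) = 0) *
  ((forall r j, wt (p r j) = 0) * (forall r j, wt (zz p r j) = 0)).
Proof. by do !split=> *; rewrite ?opr_a ?opr_s ?opr0p ?opr0z. Qed.

Lemma TE k : (forall i, T k (a i) = a (i + k)) * (forall j, T k (s j) = 0) *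
  ((forall r j, T k (p r j) = 0) * (forall r j, T k (zz p r j) = 0)).
Proof. by do !split=> *; rewrite ?opr_a ?opr_s ?opr0p ?opr0z. Qed.

Lemma rfE : (forall i, rf (a i) = a (- i)) * (forall j, rf (s j) = 0) *
  ((forall r j, rf (p r j) = 0) * (forall r j, rf (zz p r j) = 0)).
Proof. by do !split=> *; rewrite ?opr_a ?opr_s ?opr0p ?opr0z. Qed.

Lemma piSE : (forall i, piS (a i) = 0) * (forall j, piS (s j) = s j) *
  ((forall r j, piS (p r j) = 0) * (forall r j, piS (zz p r j) = 0)).
Proof. by do !split=> *; rewrite ?opr_a ?opr_s ?opr0p ?opr0z. Qed.

Lemma kapE : (forall i, kap (a i) = s (absz i)) * (forall j, kap (s j) = 0) *
  ((forall r j, kap (p r j) = 0) * (forall r j, kap (zz p r j) = 0)).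
Proof. by do !split=> *; rewrite ?opr_a ?opr_s ?opr0p ?opr0z. Qed.

Lemma iotE : (forall i, iot (a i) = 0) * (forall j,
    iot (s j) = (3%:R / 4%:R) *: a 0 - (3%:R / 8%:R) *: (a j%:Z + a (- j%:Z))) *
  ((forall r j, iot (p r j) = 0) * (forall r j, iot (zz p r j) = 0)).
Proof. by do !split=> *; rewrite ?opr_a ?opr0p ?opr0z ?opr_s //= (_ : - 0%:Z = 0) //; vring. Qed.

Lemma piPE : (forall i, piP (a i) = 0) * (forall j, piP (s j) = 0) *
  ((forall r j, piP (p r j) = p r j) * (forall r j, piP (zz p r j) = zz p r j)).
Proof. by do !split=> *; rewrite /zz ?opE ?opr_a ?opr_s ?opr_p. Qed.

Let evE := (wtE, TE, rfE, piSE, kapE, iotE, piPE).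

(** * Products with the generators, at all indices *)

Lemma ad_aa i k : ad (a k) (a i) =
  2^-1 *: (a k + a i) + s (absz (k - i)) + zz p (ibar k) (absz (k - i)).
Proof. by rewrite adE H1. Qed.

Lemma ad_as k j : ad (a k) (s j) = - (3%:R / 4%:R) *: a k
  + (3%:R / 8%:R) *: (a (k - j%:Z) + a (k + j%:Z)) + (3%:R / 2%:R) *: s j - zz p (ibar k) j.
Proof.
case: j => [|j]; last by rewrite adE H2.
by rewrite hs0 op0 scaler0 zz3 // !(subr0, addr0); vring.
Qed.

Lemma ad_ap i r k : ad (a i) (p r k) = (3%:R / 2%:R) *: p r k - p (- (ibar i + r)) k.
Proof.
have [/andP[k0 k3]|kn] := boolP ((0 < k)%N && (3 %| k)%N); first by rewrite adE H3.
by rewrite !hp3N // op0; vring.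
Qed.

Lemma ad_az i r k : ad (a i) (zz p r k) = (3%:R / 2%:R) *: zz p r k + zz p (- (ibar i + r)) k.
Proof.
rewrite /zz !opE !ad_ap.
have -> : - (ibar i + (r + 1)) = - (ibar i + r) - 1 by ring.
have -> : - (ibar i + (r - 1)) = - (ibar i + r) + 1 by ring.
by vring.
Qed.

Lemma ad_sa k j : ad (s j) (a k) = - (3%:R / 4%:R) *: a k
  + (3%:R / 8%:R) *: (a (k - j%:Z) + a (k + j%:Z)) + (3%:R / 2%:R) *: s j - zz p (ibar k) j.
Proof. by rewrite -ad_as !adE mulC. Qed.

Lemma ad_ss j l : (0 < j)%N -> ad (s j) (s l) = (3%:R / 4%:R) *: (s j + s l)
       - (3%:R / 8%:R) *: (s (absz (j%:Z - l%:Z)) + s (j + l)%N).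
Proof.
case: l => [|l] j0; last by rewrite adE H4.
by rewrite hs0 op0 subr0 absz_nat addn0; vring.
Qed.

(** For k in 3N none of j, |j - k|, j + k is divisible by 3, so three of the four terms of (H5)
    vanish. *)
Lemma ad_sp j r k : (0 < j)%N -> ~~ (3 %| j)%N -> ad (s j) (p r k) = (3%:R / 4%:R) *: p r k.
Proof.
move=> j0 j3; have [/andP[k0 k3]|kn] := boolP ((0 < k)%N && (3 %| k)%N); last first.
  by rewrite !hp3N // op0 scaler0.
rewrite adE H5 // [p r j]hp3N ?(negPf j3) ?andbF //.
rewrite [p r (absz _)]hp3N ?[p r (_ + _)%N]hp3N; first by vring.
- by rewrite dvdn_addl // negb_and j3 orbT.
- by apply: contra j3 => /andP[_]; lia.
Qed.

Lemma ad_s3p r k : (3 %| k)%N -> ad (s 3) (p r k) = (3%:R / 4%:R) *: (p r 3 + p r k)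
       - (3%:R / 8%:R) *: (p r (absz (3%:Z - k%:Z)) + p r (3 + k)%N).
Proof.
by case: k => [_|k k3]; [rewrite [p r 0]hp3N // op0 subr0 addn0; vring|rewrite adE H5].
Qed.

Lemma ad_s12a j k : (0 < j < 3)%N -> ad (s j) (a k) = - (3%:R / 4%:R) *: a k
  + (3%:R / 8%:R) *: (a (k - j%:Z) + a (k + j%:Z)) + (3%:R / 2%:R) *: s j.
Proof. by move=> j3; rewrite ad_sa zz3 ?subr0 //; lia. Qed.

Lemma ad_s12p j r k : (0 < j < 3)%N -> ad (s j) (p r k) = (3%:R / 4%:R) *: p r k.
Proof. by move=> j3; rewrite ad_sp //; lia. Qed.

Lemma ad_s12s j l : (0 < j < 3)%N -> ad (s j) (s l) = (3%:R / 4%:R) *: (s j + s l)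
       - (3%:R / 8%:R) *: (s (absz (j%:Z - l%:Z)) + s (j + l)%N).
Proof. by move=> /andP[j0 _]; apply: ad_ss. Qed.

Ltac lin := move=> ? ? ?; rewrite ?opE; vring.

Ltac index_norm := repeat match goal with
  | |- context [a ?x] => match goal with |- context [a ?y] =>
      tryif unify x y then fail else (have -> : a y = a x by congr a; lia) end
  | |- context [s ?x] => match goal with |- context [s ?y] =>
      tryif unify x y then fail else (have -> : s y = s x by congr s; lia) end
  | |- context [s ?x] => (have -> : s x = 0 by rewrite -hs0; congr s; lia)
  end.

Ltac op_ext := apply: basis_ext; [lin | lin | ..];
  [move=> ? | move=> ? ? | move=> ? ? ? ?];
  rewrite ?(opE, evE, ad_aa, ad_as, ad_ap, ad_az, ad_s12a, ad_s12s, ad_s12p) //;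
  index_norm; vring.

(** * Products modulo P, read in Laurent polynomials *)

Lemma T0_ad_a k v :
  T 0 (ad (a k) v) = 2^-1 *: T k (wt v) + 2^-1 *: T 0 v - T k (iot v).
Proof. move: v; op_ext. Qed.

Lemma piS_ad_a k v : piS (ad (a k) v) = kap (T (- k) v) + (3%:R / 2%:R) *: piS v.
Proof. move: v; op_ext. Qed.

Lemma wt_ad_a k v : wt (ad (a k) v) = wt v.
Proof. move: v; op_ext. Qed.

Lemma T0_ad_s j v : (0 < j < 3)%N ->
  T 0 (ad (s j) v) = (3%:R / 8%:R) *: (T j%:Z v + T (- j%:Z) v) - (3%:R / 4%:R) *: T 0 v.
Proof. move=> j3; move: v; op_ext. Qed.

Lemma piS_ad_s j v : (0 < j < 3)%N ->
  piS (ad (s j) v) = ad (s j) (piS v) + piS (ad (s j) (wt v)).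
Proof. move=> j3; move: v; op_ext. Qed.

Lemma wt_ad_s j v : (0 < j < 3)%N -> wt (ad (s j) v) = 0.
Proof. move=> j3; move: v; op_ext. Qed.

Lemma ad_s_piP j v : (0 < j < 3)%N -> ad (s j) (piP v) = (3%:R / 4%:R) *: piP v.
Proof. move=> j3; move: v; op_ext. Qed.

Lemma T_T k l v : T k (T l v) = T (k + l) v.
Proof. move: v; op_ext. Qed.

Lemma wt_T k v : wt (T k v) = wt v.
Proof. move: v; op_ext. Qed.

Lemma rf_T k v : rf (T k v) = T (- k) (rf v).
Proof. move: v; op_ext. Qed.

Lemma iot_kap v : iot (kap v) = (3%:R / 4%:R) *: wt v - (3%:R / 8%:R) *: (T 0 v + rf v).
Proof.
move: v; apply: basis_ext; [lin | lin | move=> i | move=> j _ | move=> *];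
  rewrite !(opE, evE); first last.
- by vring.
- by vring.
have [e|e] : (absz i)%:Z = i \/ (absz i)%:Z = - i by lia.
  by rewrite e; index_norm; vring.
by rewrite e opprK; index_norm; vring.
Qed.

Lemma kap_iot v : kap (iot v) = - (3%:R / 4%:R) *: piS v.
Proof. move: v; op_ext. Qed.

(** The factor 2 - t - 1/t is 8/3 times [iot (s 1)], and [kap] undoes [iot] up to the factor
    -3/4. *)
Lemma kap_T_iot v :
  kap (2%:R *: iot v - T 1 (iot v) - T (-1) (iot v)) = - 2%:R *: ad (s 1) (piS v).
Proof. move: v; op_ext. Qed.

Lemma decomp_piP v : v = T 0 v + piS v + piP v.
Proof. move: v; op_ext. Qed.

Lemma piS_iot v : iot (piS v) = iot v.
Proof. move: v; op_ext. Qed.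

(* For j in {1,2}, [shifted j] vanishes on P and acts on S as t^j + t^-j; hence
   [killS], which mimics (t^2 + t^-2) + 2 - (t + t^-1)^2, vanishes on S and fixes P. *)
Lemma shifted_linear j : linear (fun v => - (8%:R / 3%:R) *: (ad (s j) v - (3%:R / 4%:R) *: v)).
Proof. lin. Qed.

Definition shifted j : linop V := locked (Linop (shifted_linear j)).

Lemma shiftedE j v : shifted j v = - (8%:R / 3%:R) *: (ad (s j) v - (3%:R / 4%:R) *: v).
Proof. by rewrite /shifted -lock. Qed.

Lemma killS_linear :
  linear (fun v => 2^-1 *: (shifted 2 v + 2%:R *: v - shifted 1 (shifted 1 v))).
Proof. lin. Qed.

Definition killS : linop V := locked (Linop killS_linear).

Lemma killSE v : killS v = 2^-1 *: (shifted 2 v + 2%:R *: v - shifted 1 (shifted 1 v)).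
Proof. by rewrite /killS -lock. Qed.

Lemma shifted_s j l : (0 < j < 3)%N ->
  shifted j (s l) = s (absz (j%:Z - l%:Z)) + s (j + l)%N - 2%:R *: s j.
Proof. by move=> j3; rewrite shiftedE ad_s12s //; vring. Qed.

Lemma killS_piS v : killS (piS v) = 0.
Proof.
move: v; apply: basis_ext => [||i|j j0|r k _ _]; [lin | lin | ..]; rewrite !evE ?op0 //.
rewrite killSE !(opE, shifted_s) //.
(* With j = 1 set apart, 1 - j and 2 - j have definite signs. *)
case: j j0 => [//|[|l]] _; index_norm; vring.
Qed.

Lemma shifted_piP j v : (0 < j < 3)%N -> shifted j (piP v) = 0.
Proof. by move=> j3; rewrite shiftedE ad_s_piP //; vring. Qed.

Lemma killS_piP v : killS (piP v) = piP v.
Proof. by rewrite killSE !shifted_piP // op0; vring. Qed.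

(** * The module P *)

Lemma T0_T0 v : T 0 (T 0 v) = T 0 v.
Proof. by rewrite T_T. Qed.

Lemma piP_P v : T 0 v = 0 -> piS v = 0 -> piP v = v.
Proof. by move=> A0 S0; rewrite [RHS]decomp_piP A0 S0 !add0r. Qed.

Lemma T_piP k v : T k (piP v) = 0.
Proof. move: v; op_ext. Qed.

Lemma piS_piP v : piS (piP v) = 0.
Proof. move: v; op_ext. Qed.

Lemma wt_piP v : wt (piP v) = 0.
Proof. move: v; op_ext. Qed.

Lemma iot_piP v : iot (piP v) = 0.
Proof. move: v; op_ext. Qed.

Lemma piP_ad_a_piP k v : piP (ad (a k) (piP v)) = ad (a k) (piP v).
Proof.
apply: piP_P; first by rewrite T0_ad_a wt_piP iot_piP T_piP !opE; vring.
by rewrite piS_ad_a T_piP piS_piP !opE; vring.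
Qed.

(** On P, a_k acts as 3/2 minus the involution r ↦ -(k + r) of the first index, so its eigenvalues
    are among 1/2 and 5/2. *)
Lemma ad_a_quadratic k v : ad (a k) (ad (a k) (piP v)) =
  3%:R *: ad (a k) (piP v) - (5%:R / 4%:R) *: piP v.
Proof.
move: v; apply: basis_ext => [||i|j j0|r l _ _]; [lin | lin | ..]; rewrite !evE ?opE; try by vring.
rewrite !(opE, ad_ap) (_ : - (ibar k + - (ibar k + r)) = r); last by ring.
vring.
Qed.

Lemma piP_ad_s3_piP v : piP (ad (s 3) (piP v)) = ad (s 3) (piP v).
Proof.
move: v; apply: basis_ext => [||i|j j0|r l _ l3]; [lin | lin | ..]; rewrite !evE ?opE //.
by rewrite ad_s3p // !opE !evE.
Qed.

Lemma ad_a_s3_piP k v : ad (a k) (ad (s 3) (piP v)) = ad (s 3) (ad (a k) (piP v)).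
Proof.
move: v; apply: basis_ext => [||i|j j0|r l _ l3]; [lin | lin | ..]; rewrite !evE ?opE //.
by rewrite !(ad_s3p, ad_ap, opE) //; vring.
Qed.

(** This is h(s_3) z_{r,3}. For fixed h the three vectors sum to zero, and a_k - 3/2 permutes them
    by the reflection r ↦ -(k + r). *)
Definition pz (r : 'Z_3) := pcomb (fun i => iter i (ad (s 3)) (zz p r 3)).

Lemma pzD r g h : pz r (g + h) = pz r g + pz r h.
Proof. exact: linearD. Qed.

Lemma pzN r h : pz r (- h) = - pz r h.
Proof. exact: linearN. Qed.

Lemma pzZ r c h : pz r (c *: h) = c *: pz r h.
Proof. exact: linearZ_LR. Qed.

Lemma pz0 r : pz r 0 = 0.
Proof. exact: linear0. Qed.

Lemma pzMX r h : pz r (h * 'X) = ad (s 3) (pz r h).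
Proof. by rewrite /pz pcombMX (op_pcomb (w' := fun i => iter i.+1 (ad (s 3)) (zz p r 3))). Qed.

Lemma piP_iter r i : piP (iter i (ad (s 3)) (zz p r 3)) = iter i (ad (s 3)) (zz p r 3).
Proof.
by elim: i => [|i IH] /=; [exact: piPE.2.2|rewrite -IH piP_ad_s3_piP].
Qed.

Lemma piP_pz r h : piP (pz r h) = pz r h.
Proof. by apply: op_pcomb => i; exact: piP_iter. Qed.

Lemma ad_a_pz k r h : ad (a k) (pz r h) = (3%:R / 2%:R) *: pz r h + pz (- (ibar k + r)) h.
Proof.
have E i : ad (a k) (iter i (ad (s 3)) (zz p r 3)) =
    (3%:R / 2%:R) *: iter i (ad (s 3)) (zz p r 3) + iter i (ad (s 3)) (zz p (- (ibar k + r)) 3).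
  elim: i => [|i IH] /=; first exact: ad_az.
  by rewrite -{1}piP_iter ad_a_s3_piP piP_iter IH !opE.
rewrite /pz (op_pcomb _ E) /pcomb scaler_sumr -big_split; apply: eq_bigr => i _.
by vring.
Qed.

(** (H5) gives a three-term recurrence of Chebyshev type in k, so the induction carries two
    consecutive values. *)
Lemma pz_zz k : exists h, forall r, zz p r (3 * k) = pz r h.
Proof.
suff [//] : (exists h, forall r, zz p r (3 * k) = pz r h) /\
            (exists h, forall r, zz p r (3 * k.+1) = pz r h).
have pz1 r' : pz r' 1 = zz p r' 3 by rewrite -(expr0 'X) /pz pcombXn.
elim: k => [|k [[g Hg] [h Hh]]]; split.
- by exists 0 => r'; rewrite pz0 zz3.
- by exists 1 => r'; rewrite pz1.
- by exists h.
(* (H5) solved for z_{r,3(k+2)}, with X in place of s_3. *)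
exists (2%:R *: (1 + h) - g - (8%:R / 3%:R) *: (h * 'X)) => r'.
rewrite !(pzD, pzN, pzZ) pzMX pz1 -Hg -Hh /zz !opE !ad_s3p ?dvdn_mulr //.
have -> : (3 + 3 * k.+1 = 3 * k.+2)%N by lia.
have -> : absz (3%:Z - (3 * k.+1)%N%:Z) = (3 * k)%N by lia.
by vring.
Qed.

Lemma zz_0 k : zz p 0 k = p 1 k - p 2%:R k.
Proof. by rewrite /zz; congr (p _ _ - p _ _); apply: val_inj. Qed.

Lemma zz_1 k : zz p 1 k = p 1 k + 2%:R *: p 2%:R k.
Proof.
rewrite /zz (_ : 1 + 1 = 2%:R) ?subrr ?hp0; last exact: val_inj.
by vring.
Qed.

Lemma zz_2 k : zz p 2%:R k = - zz p 0 k - zz p 1 k.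
Proof.
have e1 : 2%:R + 1 = 0 :> 'Z_3 by apply: val_inj.
have e2 : 2%:R - 1 = 1 :> 'Z_3 by apply: val_inj.
by rewrite zz_0 zz_1 /zz e1 e2 (hp0 k); vring.
Qed.

Lemma pz_2 h : pz 2%:R h = - pz 0 h - pz 1 h.
Proof.
rewrite /pz /pcomb -!sumrN -big_split; apply: eq_bigr => i _.
have -> : iter i (ad (s 3)) (zz p 2%:R 3) =
    - iter i (ad (s 3)) (zz p 0 3) - iter i (ad (s 3)) (zz p 1 3).
  by elim: (nat_of_ord i) => [|m IH]; [exact: zz_2|rewrite !iterS IH !opE].
by vring.
Qed.

Lemma piP_pz_ex v : exists h1 h2, piP v = pz 0 h1 + pz 1 h2.
Proof.
pose Q u := exists h1 h2, u = pz 0 h1 + pz 1 h2.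
have Q0 : Q 0 by exists 0, 0; rewrite !pz0 addr0.
have Qlin c x y : Q x -> Q y -> Q (c *: x + y).
  move=> [h1 [h2 ->]] [g1 [g2 ->]]; exists (c *: h1 + g1), (c *: h2 + g2).
  by rewrite !(pzD, pzZ); vring.
apply: (span_ind hbas (P := fun v => Q (piP v))); first by rewrite op0.
  by move=> c x y; rewrite !opE; exact: Qlin.
move=> [i|[j|[b k]]] /=; rewrite ?evE //.
have [h Hh] := pz_zz k.+1.
have Q2 : Q (p 2%:R (3 * k.+1)%N).
  (* Here p_2 = (z_1 - z_0)/3. *)
  exists (- (3%:R^-1 *: h)), (3%:R^-1 *: h).
  rewrite !(pzN, pzZ, =^~ Hh) zz_0 zz_1 /=; vring.
case: b; last exact: Q2.
have -> : p 1 (3 * k.+1)%N = 1 *: p 2%:R (3 * k.+1)%N + zz p 0 (3 * k.+1)%N by rewrite zz_0; vring.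
by apply: Qlin => //; exists h, 0; rewrite Hh pz0 addr0.
Qed.

(** * Elements of weight zero *)

Lemma T_T0 k v : T k (T 0 v) = T k v.
Proof. by rewrite T_T addr0. Qed.

Lemma T_vanish k v : T 0 v = 0 -> T k v = 0.
Proof. by move=> v0; rewrite -T_T0 v0 op0. Qed.

Lemma T0_iot v : T 0 (iot v) = iot v.
Proof. move: v; op_ext. Qed.

Lemma kap_rf v : kap (rf v) = kap v.
Proof. move: v; op_ext. Qed.

Lemma rf_T0 v : rf (T 0 v) = rf v.
Proof. move: v; op_ext. Qed.

Lemma T0_rf v : T 0 (rf v) = rf v.
Proof. move: v; op_ext. Qed.

Lemma iot_vanish v : piS v = 0 -> iot v = 0.
Proof. by move=> v0; rewrite -piS_iot v0 op0. Qed.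

Lemma T_ad_a l k v : wt v = 0 -> T l (ad (a k) v) = 2^-1 *: T l v - T (l + k) (iot v).
Proof. by move=> v0; rewrite -T_T0 T0_ad_a v0 !opE !T_T addr0; vring. Qed.

Lemma iot_ad_a k v : wt v = 0 -> iot (ad (a k) v) =
  - (3%:R / 8%:R) *: (T (- k) v + T k (rf v)) + (3%:R / 2%:R) *: iot v.
Proof.
move=> v0; rewrite -piS_iot piS_ad_a !opE iot_kap piS_iot wt_T v0 T_T rf_T opprK add0r.
by vring.
Qed.

(** Passing from A to S symmetrises t^-k f, and passing back multiplies by t^k. With L the
    multiplication by a_k, the product L (L - 2) is the one whose S-part cancels. *)
Lemma ad_a_antisym k v : wt v = 0 ->
  let u := ad (a k) (ad (a k) v - 2%:R *: v) in
  T 0 u = - (3%:R / 8%:R) *: (T 0 v - T (k + k) (rf v)) /\ piS u = 0.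
Proof.
move=> v0; have x0 : wt (ad (a k) v - 2%:R *: v) = 0 by rewrite !opE wt_ad_a v0; vring.
split.
  rewrite T_ad_a // !opE iot_ad_a // T_ad_a // !opE !T_T add0r subrr.
  by vring.
rewrite piS_ad_a !opE piS_ad_a T_ad_a // addNr !opE T0_iot kap_iot.
by vring.
Qed.

Lemma Z3_ibar (r : 'Z_3) : exists k : int, ibar k = r.
Proof. by exists (val r)%:Z; rewrite /ibar -pmulrn natr_Zp. Qed.

Lemma half_linear : linear (fun v => ad (a 0) v - 2^-1 *: v).
Proof. lin. Qed.

(** On P this is twice the projection to the 5/2-eigenspace of a_0 along the 1/2-eigenspace. *)
Definition half : linop V := locked (Linop half_linear).

Lemma halfE v : half v = ad (a 0) v - 2^-1 *: v.
Proof. by rewrite /half -lock. Qed.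

Lemma piP_half v : piP (half (piP v)) = half (piP v).
Proof. by rewrite halfE !opE piP_ad_a_piP (piP_P (T_piP _ _) (piS_piP _)). Qed.

Lemma half_half v : half (half (piP v)) = 2%:R *: half (piP v).
Proof. by rewrite !halfE !opE ad_a_quadratic; vring. Qed.

Lemma half_pz h : half (pz 0 h) = 2%:R *: pz 0 h.
Proof. by rewrite halfE ad_a_pz /ibar addr0 oppr0; vring. Qed.

Lemma wt_half v : wt v = 0 -> wt (half v) = 0.
Proof. by move=> v0; rewrite halfE !opE wt_ad_a v0; vring. Qed.

Lemma T0_half v : wt v = 0 -> piS v = 0 -> T 0 (half v) = 0.
Proof.
by move=> v0 s0; rewrite halfE !opE T_ad_a // iot_vanish // op0; vring.
Qed.

Lemma wt_shifted j v : (0 < j < 3)%N -> wt v = 0 -> wt (shifted j v) = 0.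
Proof. by move=> j3 v0; rewrite shiftedE !opE wt_ad_s // v0; vring. Qed.

Lemma piS_shifted j v : (0 < j < 3)%N -> wt v = 0 -> piS (shifted j v) = shifted j (piS v).
Proof. by move=> j3 v0; rewrite !shiftedE !opE piS_ad_s // v0 !opE; vring. Qed.

Lemma T0_shifted j v : (0 < j < 3)%N -> T 0 v = 0 -> T 0 (shifted j v) = 0.
Proof.
move=> j3 v0; have Tv l : T l v = 0 by exact: T_vanish.
by rewrite !shiftedE !opE T0_ad_s // !Tv; vring.
Qed.

Lemma wt_killS v : wt v = 0 -> wt (killS v) = 0.
Proof. by move=> v0; rewrite killSE !opE !wt_shifted // v0; vring. Qed.

Lemma piS_killS v : wt v = 0 -> piS (killS v) = 0.
Proof.
move=> v0; rewrite killSE !opE !piS_shifted ?wt_shifted //.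
by rewrite -killSE killS_piS.
Qed.

Lemma T0_killS v : T 0 v = 0 -> T 0 (killS v) = 0.
Proof.
move=> v0; have Tj j w : (0 < j < 3)%N -> T 0 w = 0 -> T 0 (shifted j w) = 0 by exact: T0_shifted.
by rewrite killSE !opE !(Tj _ _ _ (Tj _ _ _ v0), Tj _ _ _ v0) // v0; vring.
Qed.

(* The operator R of the header; it takes values in the (5/2)-eigenspace of [a 0] in P. *)
Definition proj v := half (killS (half (killS v))).

Lemma projB x y : proj (x + y) = proj x + proj y.
Proof. by rewrite /proj !opE. Qed.

Lemma projZ c x : proj (c *: x) = c *: proj x.
Proof. by rewrite /proj !opE. Qed.

Lemma proj_pz h : proj (pz 0 h) = 4%:R *: pz 0 h.
Proof.
have k : killS (pz 0 h) = pz 0 h by rewrite -piP_pz killS_piP.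
by rewrite /proj k half_pz opZ k opZ half_pz; vring.
Qed.

(** The first [killS] removes the S-part, [half] then removes the A-part but may create an S-part,
    and the second [killS] removes that. *)
Lemma killS_half_killS v : wt v = 0 ->
  piP (killS (half (killS v))) = killS (half (killS v)).
Proof.
move=> v0; have w0 := wt_killS v0.
apply: piP_P; first by rewrite T0_killS // T0_half // piS_killS.
by rewrite piS_killS // wt_half.
Qed.

Lemma piP_proj v : wt v = 0 -> piP (proj v) = proj v.
Proof. by move=> /killS_half_killS v0; rewrite /proj -v0 piP_half. Qed.

Lemma proj_proj v : wt v = 0 -> proj (proj v) = 4%:R *: proj v.
Proof.
move=> v0; have h2 : half (proj v) = 2%:R *: proj v.
  by rewrite /proj -killS_half_killS // half_half.
have k1 : killS (proj v) = proj v by rewrite -piP_proj // killS_piP.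
by rewrite {1}/proj k1 h2 opZ k1 opZ h2; vring.
Qed.

(** * Closure properties of ideals, and ideals of nonzero weight *)

Section Ideal.

Context (I : V -> Prop) (hI : is_ideal mul I).

Lemma ideal0 : I 0.
Proof. by case: hI. Qed.

Lemma ideal_lin c x y : I x -> I y -> I (c *: x + y).
Proof. by case: hI => _ h _; apply: h. Qed.

Lemma idealZ c x : I x -> I (c *: x).
Proof. by move=> Ix; rewrite -[_ *: _]addr0; apply: ideal_lin => //; exact: ideal0. Qed.

Lemma idealD x y : I x -> I y -> I (x + y).
Proof. by move=> Ix Iy; rewrite -[x]scale1r; apply: ideal_lin. Qed.

Lemma idealB x y : I x -> I y -> I (x - y).
Proof. by move=> Ix Iy; rewrite addrC -scaleN1r; apply: ideal_lin. Qed.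

Lemma ideal_ad u v : I v -> I (ad u v).
Proof. by case: hI => _ _ h /(h u) []. Qed.

Lemma ideal_unscale c x : c != 0 -> I (c *: x) -> I x.
Proof. by move=> c0 /(idealZ c^-1); rewrite scalerA mulVf // scale1r. Qed.

Lemma ideal_half v : I v -> I (half v).
Proof. by move=> Iv; rewrite halfE; apply: idealB; [apply: ideal_ad|apply: idealZ]. Qed.

Lemma ideal_shifted j v : I v -> I (shifted j v).
Proof. by move=> Iv; rewrite shiftedE; apply/idealZ/idealB; [apply: ideal_ad|apply: idealZ]. Qed.

Lemma ideal_killS v : I v -> I (killS v).
Proof.
move=> Iv; rewrite killSE; apply/idealZ/idealB; last by do 2!apply: ideal_shifted.
by apply: idealD; [apply: ideal_shifted|apply: idealZ].
Qed.

Lemma ideal_proj v : I v -> I (proj v).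
Proof. by move=> Iv; apply/ideal_half/ideal_killS/ideal_half/ideal_killS. Qed.

(** As a_k - 3/2 sends index r to -(k + r), k is taken congruent to -(r + t). *)
Lemma ideal_pz r t h : I (pz r h) -> I (pz t h).
Proof.
have [k kE] := Z3_ibar (- (r + t)) => Ir.
have -> : pz t h = ad (a k) (pz r h) - (3%:R / 2%:R) *: pz r h.
  by rewrite ad_a_pz kE opprD opprK (_ : r + t - r = t); [vring|ring].
by apply: idealB; [apply: ideal_ad|apply: idealZ].
Qed.

(** With z_r standing for [pz r h]: a_0 - 5/2 annihilates [pz 0 g] and yields z_2 - z_1, which a_2 -
    3/2 sends to z_2 - z_0. These add up to 3 z_2, since z_0 + z_1 + z_2 = 0. *)
Lemma ideal_pz_split g h : I (pz 0 g + pz 1 h) -> I (pz 0 g) /\ I (pz 0 h).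
Proof.
move=> Iu; have h2 : I (pz 2%:R h).
  have [k0 E0] := Z3_ibar 0; have [k2 E2] := Z3_ibar 2%:R.
  have e00 : - (0 + 0) = 0 :> 'Z_3 by apply: val_inj.
  have e01 : - (0 + 1) = 2%:R :> 'Z_3 by apply: val_inj.
  have e22 : - (2%:R + 2%:R) = 2%:R :> 'Z_3 by apply: val_inj.
  have e21 : - (2%:R + 1) = 0 :> 'Z_3 by apply: val_inj.
  have I1 : I (pz 2%:R h - pz 1 h).
    have -> : pz 2%:R h - pz 1 h = ad (a k0) (pz 0 g + pz 1 h) - (5%:R / 2%:R) *: (pz 0 g + pz 1 h).
      by rewrite opD !ad_a_pz E0 e00 e01; vring.
    by apply: idealB; [apply: ideal_ad|apply: idealZ].
  have I2 : I (pz 2%:R h - pz 0 h).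
    have -> : pz 2%:R h - pz 0 h =
        ad (a k2) (pz 2%:R h - pz 1 h) - (3%:R / 2%:R) *: (pz 2%:R h - pz 1 h).
      by rewrite opD opN !ad_a_pz E2 e22 e21; vring.
    by apply: idealB; [apply: ideal_ad|apply: idealZ].
  have -> : pz 2%:R h = 3%:R^-1 *: ((pz 2%:R h - pz 1 h) + (pz 2%:R h - pz 0 h)).
    by rewrite pz_2; vring.
  by apply/idealZ/idealD.
split; last exact: ideal_pz h2.
have -> : pz 0 g = pz 0 g + pz 1 h - pz 1 h by vring.
by apply: idealB => //; exact: ideal_pz h2.
Qed.

Lemma wt_scalar v : exists c, wt v = c *: a 0.
Proof.
move: v; apply: (span_ind hbas); first by exists 0; rewrite op0 scale0r.
  by move=> c x y [d dE] [e eE]; exists (c * d + e); rewrite !opE dE eE; vring.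
by move=> [i|[j|[r k]]] /=; rewrite wtE; [exists 1|exists 0|exists 0]; rewrite ?scale1r ?scale0r.
Qed.

(* [(L - 5/2) (L - 1/2)^2 (L - 2) L], for [L] the multiplication by [a k], kills the
   elements of weight zero and multiplies [a k] by [3/8]. *)
Lemma ideal_a v k : I v -> wt v != 0 -> I (a k).
Proof.
move=> Iv v0; pose L := ad (a k); pose q2 x := L (L x - 2%:R *: x).
pose q1 x := L (q2 x) - 2^-1 *: q2 x.
pose q x := L (L (q1 x)) - 3%:R *: L (q1 x) + (5%:R / 4%:R) *: q1 x.
have qk w : wt w = 0 -> q w = 0.
  move=> w0; have [A2 S2] := ad_a_antisym k w0; rewrite -/L -/(q2 w) in A2 S2.
  have w2 : wt (q2 w) = 0 by rewrite wt_ad_a !opE wt_ad_a w0; vring.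
  have p1 : piP (q1 w) = q1 w.
    apply: piP_P; first by rewrite !opE T_ad_a // iot_vanish // op0; vring.
    (* The A-part of [q2 w] is antisymmetric under t^i ↦ t^(2k-i), so [kap] annihilates its shift by
       -k. *)
    rewrite !opE piS_ad_a S2 -T_T0 A2 !opE T_T0 T_T -(kap_rf (T (- k) w)) rf_T opprK.
    rewrite addrA addNr add0r.
    by vring.
  by rewrite /q -p1 ad_a_quadratic p1; vring.
have La : L (a k) = a k.
  by rewrite /L ad_aa subrr hs0 zz3 //; vring.
have [c vE] := wt_scalar v.
have c0 : c != 0 by apply: contra_neq v0 => c0; rewrite vE c0 scale0r.
have qv : q v = (c * (3%:R / 8%:R)) *: a k.
  have -> : q v = q (v - c *: a k) + c *: q (a k) by rewrite /q /q1 /q2 !opE; vring.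
  rewrite qk; last by rewrite !opE wtE vE subrr.
  by rewrite /q /q1 /q2 !(opE, La); vring.
apply: (@ideal_unscale (c * (3%:R / 8%:R))).
  by rewrite !mulf_neq0 ?invr_neq0 ?nz.
have I2 : I (q2 v) by apply: ideal_ad; apply: idealB; [apply: ideal_ad|apply: idealZ].
have I1 : I (q1 v) by apply: idealB; [apply: ideal_ad|apply: idealZ].
rewrite -qv; apply: idealD; last exact: idealZ.
by apply: idealB; [do 2!apply: ideal_ad|apply/idealZ/ideal_ad].
Qed.

(** By (H1) the a_i yield s_j + z_{r,j} for every r. Summing over r isolates 3 s_j, since the
    z_{r,j} sum to zero. *)
Lemma ideal_full v u : I v -> wt v != 0 -> I u.
Proof.
move=> Iv v0; have Ia k : I (a k) by exact: ideal_a Iv v0.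
have Isz (k : int) j : I (s j + zz p (ibar k) j).
  have -> : s j + zz p (ibar k) j = ad (a k) (a (k - j%:Z)) - 2^-1 *: (a k + a (k - j%:Z)).
    by rewrite ad_aa (_ : absz (k - (k - j%:Z))%R = j); [vring|lia].
  by apply: idealB; [apply: ideal_ad|apply/idealZ/idealD].
have [[k0 E0] [[k1 E1] [k2 E2]]] := (Z3_ibar 0, (Z3_ibar 1, Z3_ibar 2%:R)).
have Is j : I (s j).
  have -> : s j = 3%:R^-1 *: ((s j + zz p (ibar k0) j) + (s j + zz p (ibar k1) j)
    + (s j + zz p (ibar k2) j)) by rewrite E0 E1 E2 zz_2; vring.
  exact/idealZ/(idealD (idealD (Isz k0 j) (Isz k1 j)) (Isz k2 j)).
have Iz k j : I (zz p (ibar k) j).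
  have -> : zz p (ibar k) j = (s j + zz p (ibar k) j) - s j by vring.
  exact: idealB.
have Ip2 j : I (p 2%:R j).
  have -> : p 2%:R j = 3%:R^-1 *: (zz p (ibar k1) j - zz p (ibar k0) j).
    by rewrite E0 E1 zz_0 zz_1; vring.
  by apply/idealZ/idealB.
move: u; apply: (span_ind hbas) ideal0 ideal_lin _ => -[i|[j|[[] j]]] //=.
have -> : p 1 (3 * j.+1)%N = zz p (ibar k0) (3 * j.+1)%N + p 2%:R (3 * j.+1)%N.
  by rewrite E0 zz_0; vring.
exact: idealD.
Qed.

(** * Ideals of weight zero, seen in Laurent polynomials *)

Hypothesis wt0 : forall v, I v -> wt v = 0.

(* The projection of I to A, and the intersection of I + P with A. *)
Definition A_image f := exists v, I v /\ T 0 v = f.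
Definition A_meet f := exists v, [/\ I v, T 0 v = f & piS v = 0].

Lemma A_image_lin c f g : A_image f -> A_image g -> A_image (c *: f + g).
Proof.
move=> [v [Iv <-]] [w [Iw <-]]; exists (c *: v + w).
by split; [apply: ideal_lin|rewrite !opE].
Qed.

Lemma A_meet_lin c f g : A_meet f -> A_meet g -> A_meet (c *: f + g).
Proof.
move=> [v [Iv <- v0]] [w [Iw <- w0]]; exists (c *: v + w).
by split; [apply: ideal_lin|rewrite !opE|rewrite !opE v0 w0 scaler0 addr0].
Qed.

(** Multiplication by a_{-k} puts the symmetrisation of t^k f into S, and a_j brings it back to A
    times t^j. The subtracted terms remove what the original A- and S-parts contribute. *)
Lemma A_image_dihedral f j k : A_image f -> A_image (T (j + k) f + T (j - k) (rf f)).
Proof.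
move=> [v [Iv <-]]; have v0 := wt0 Iv; pose u := ad (a (- k)) v.
have Iu : I u by apply: ideal_ad.
exists ((8%:R / 3%:R) *: (ad (a j) u - 2^-1 *: u - (3%:R / 2%:R) *: (ad (a j) v - 2^-1 *: v))).
split.
  apply/idealZ/idealB; last apply: idealZ; apply: idealB; by [apply: ideal_ad|apply: idealZ].
rewrite !opE !(T_ad_a _ _ v0) (T_ad_a _ _ (wt0 Iu)) /u iot_ad_a // !opE T_ad_a // !T_T rf_T0.
rewrite opprK !(add0r, addr0).
by vring.
Qed.

(** The same passage through S; here [u] has no A-part, and a_j - 3/2 maps S into A modulo P. *)
Lemma A_meet_dihedral f j k : A_meet f -> A_meet (T (j + k) f + T (j - k) (rf f)).
Proof.
move=> [v [Iv <- s0]]; have v0 := wt0 Iv; move uE : (ad (a (- k)) v - 2^-1 *: v) => u.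
have Iu : I u by rewrite -uE; apply: idealB; [apply: ideal_ad|apply: idealZ].
have Tu l : T l u = 0 by apply: T_vanish; rewrite -uE !opE T_ad_a // iot_vanish // op0; vring.
exists ((8%:R / 3%:R) *: (ad (a j) u - (3%:R / 2%:R) *: u)); split.
- by apply/idealZ/idealB; [apply: ideal_ad|apply: idealZ].
- rewrite !opE T_ad_a ?wt0 // !Tu -uE !opE iot_ad_a // iot_vanish // !opE !T_T rf_T0.
  by rewrite opprK !(add0r, addr0); vring.
- by rewrite !opE piS_ad_a Tu op0; vring.
Qed.

Lemma A_image_sum f : A_image f -> A_image (T 1 f + T (-1) f).
Proof.
(* On A-parts s_1 acts as 3/8 (t + 1/t) - 3/4. *)
move=> [v [Iv <-]]; exists ((8%:R / 3%:R) *: ad (s 1) v + 2%:R *: v).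
split; first by apply: idealD; apply: idealZ => //; apply: ideal_ad.
by rewrite !opE T0_ad_s // !T_T0; vring.
Qed.

Lemma A_meet_sum f : A_meet f -> A_meet (T 1 f + T (-1) f).
Proof.
move=> [v [Iv <- v0]]; exists ((8%:R / 3%:R) *: ad (s 1) v + 2%:R *: v); split.
- by apply: idealD; apply: idealZ => //; apply: ideal_ad.
- by rewrite !opE T0_ad_s // !T_T0; vring.
- by rewrite !opE piS_ad_s // v0 wt0 // !opE; vring.
Qed.

(** Subtracting the cases (j, k) = (0, 1) and (-1, 0) eliminates [rf f] and gives (t - 1/t) f;
    together with (t + 1/t) f this separates the two shifts. *)
Lemma shift_closed (K : V -> Prop) : (forall c f g, K f -> K g -> K (c *: f + g)) ->
  (forall f j k, K f -> K (T (j + k) f + T (j - k) (rf f))) ->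
  (forall f, K f -> K (T 1 f + T (-1) f)) ->
  forall f, K f -> K (T 1 f) /\ K (T (-1) f).
Proof.
move=> Klin Kd Ks f Kf.
have k1 := Kd f 0 1 Kf; have k2 := Kd f (-1) 0 Kf; have k3 := Ks f Kf.
have K0 : K 0 by rewrite -(addNr f) -scaleN1r; exact: Klin.
have KD x y : K x -> K y -> K (x + y) by rewrite -{2}[x]scale1r; exact: Klin.
have KZ c x : K x -> K (c *: x) by rewrite -[_ *: _]addr0 => Kx; exact: Klin.
rewrite !(add0r, addr0, subr0) in k1 k2.
split.
  have -> : T 1 f = 2^-1 *: (T 1 f + T (-1) (rf f)) + (- 2^-1 *: (T (-1) f + T (-1) (rf f))
    + 2^-1 *: (T 1 f + T (-1) f)) by vring.
  exact: (KD _ _ (KZ _ _ k1) (KD _ _ (KZ _ _ k2) (KZ _ _ k3))).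
have -> : T (-1) f = - 2^-1 *: (T 1 f + T (-1) (rf f)) + (2^-1 *: (T (-1) f + T (-1) (rf f))
  + 2^-1 *: (T 1 f + T (-1) f)) by vring.
exact: (KD _ _ (KZ _ _ k1) (KD _ _ (KZ _ _ k2) (KZ _ _ k3))).
Qed.

Lemma A_image_T f : A_image f -> A_image (T 1 f) /\ A_image (T (-1) f).
Proof. exact: (shift_closed A_image_lin A_image_dihedral A_image_sum). Qed.

Lemma A_meet_T f : A_meet f -> A_meet (T 1 f) /\ A_meet (T (-1) f).
Proof. exact: (shift_closed A_meet_lin A_meet_dihedral A_meet_sum). Qed.

Lemma A_meet_antisym k f : A_image f -> A_meet (f - T (k + k) (rf f)).
Proof.
move=> [v [Iv <-]]; have [A2 S2] := ad_a_antisym k (wt0 Iv).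
exists (- (8%:R / 3%:R) *: ad (a k) (ad (a k) v - 2%:R *: v)); split.
- by apply/idealZ/ideal_ad/idealB; [apply: ideal_ad|apply: idealZ].
- by rewrite opZ A2 rf_T0; vring.
- by rewrite opZ S2 scaler0.
Qed.

(** Applying a_1 - a_0 twice turns the S-part x of [v] into the S-part 2 s_1 x, which subtracting 2
    s_1 v cancels. *)
Lemma A_meet_cubic f : A_image f ->
  A_meet (6%:R *: f - 3%:R *: T 1 f - 3%:R *: T (-1) f + (T 2 (rf f) - 2%:R *: T 1 (rf f) + rf f)).
Proof.
move=> [v [Iv <-]]; have v0 := wt0 Iv.
move wE : (ad (a 1) v - ad (a 0) v) => w.
have Iw : I w by rewrite -wE; apply: idealB; exact: ideal_ad.
have Tw l : T l w = T l (iot v) - T (l + 1) (iot v).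
  by rewrite -wE !opE !T_ad_a // addr0; vring.
have iw : iot w = (3%:R / 8%:R) *: (T 0 v + rf v - T (-1) v - T 1 (rf v)).
  by rewrite -wE !opE !iot_ad_a // oppr0 T0_rf; vring.
exists ((8%:R / 3%:R) *: (ad (a 1) w - ad (a 0) w - 2%:R *: ad (s 1) v)); split.
- apply/idealZ/idealB; last exact/idealZ/ideal_ad.
  by apply: idealB; exact: ideal_ad.
- rewrite !opE T0_ad_s // !(T_ad_a _ _ (wt0 Iw)) iw !opE !T_T !rf_T0 !(add0r, addr0) addrN T0_rf.
  rewrite (_ : 1 + 1 = 2) //.
  by vring.
- rewrite !opE piS_ad_s // v0 !op0 addr0 !piS_ad_a !Tw !opE oppr0 add0r addNr T0_iot.
  have := kap_T_iot v; rewrite !opE => E.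
  have -> : ad (s 1) (piS v) = - 2^-1 *: (- 2%:R *: ad (s 1) (piS v)) by vring.
  by rewrite -E; vring.
Qed.

(** Put f' = [rf f]. Modulo [A_meet], f ≡ f' ≡ t^2 f', so t f ≡ t f' ≡ f/t, and the element of
    [A_meet_cubic] becomes 8 (1 - t) f. *)
Lemma A_meet_Tsub f : A_image f -> A_meet (T 1 f - f).
Proof.
move=> If; have f0 : T 0 f = f by case: If => v [_ <-]; rewrite T0_T0.
have n1 := A_meet_antisym 0 If; have n2 := A_meet_antisym 1 If; have n3 := A_meet_cubic If.
have [Tn1 _] := A_meet_T n1; have [_ Tn2] := A_meet_T n2.
have N0 : A_meet 0 by have := A_meet_lin (-1) n1 n1; rewrite scaleN1r addNr.
rewrite -[T 1 f - f]addr0.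
have -> : T 1 f - f + 0 = (- (8%:R^-1)) *: (6%:R *: f - 3%:R *: T 1 f - 3%:R *: T (-1) f
     + (T 2 (rf f) - 2%:R *: T 1 (rf f) + rf f))
  + (- (3%:R / 8%:R) *: T (-1) (f - T (1 + 1) (rf f))
  + ((5%:R / 8%:R) *: T 1 (f - T (0 + 0) (rf f))
  + (- (8%:R^-1) *: (f - T (0 + 0) (rf f))
  + (- (8%:R^-1) *: (f - T (1 + 1) (rf f)) + 0)))).
  rewrite !opE !T_T addr0 !T0_rf (_ : -1 + (1 + 1) = 1) // (_ : 1 + 1 = 2) //.
  by vring.
by do !apply: A_meet_lin.
Qed.

End Ideal.

(** * Principality for Laurent polynomials and for the P-part *)

(** These are the ideals of F[t,1/t]; the clause on [T 0] places K inside A. *)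
Definition shift_submod (K : V -> Prop) : Prop :=
  [/\ K 0, forall c f g, K f -> K g -> K (c *: f + g), forall f, K f -> T 0 f = f &
      forall f, K f -> K (T 1 f) /\ K (T (-1) f)].

Lemma shift_submod_T K f (n : nat) : shift_submod K -> K f -> K (T n%:Z f) /\ K (T (- n%:Z) f).
Proof.
case=> _ _ KT0 KT Kf; elim: n => [|n [IH1 IH2]]; first by rewrite oppr0 KT0.
have [h1 _] := KT _ IH1; have [_ h2] := KT _ IH2; rewrite !T_T in h1 h2.
by rewrite intS opprD.
Qed.

Definition apoly (h : {poly F}) : V := pcomb (fun n : nat => a n%:Z) h.

Lemma apoly0 : apoly 0 = 0.
Proof. exact: linear0. Qed.

Lemma apolyP c g h : apoly (c *: g + h) = c *: apoly g + apoly h.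
Proof. exact: linearP. Qed.

Lemma apolyMXn h (n : nat) : apoly (h * 'X^n) = T n%:Z (apoly h).
Proof.
elim: n => [|n IH].
  rewrite expr0 mulr1 /apoly; symmetry; apply: op_pcomb => i.
  by rewrite TE addr0.
rewrite exprSr mulrA /apoly pcombMX -/(apoly _).
have -> : pcomb ((fun n => a n%:Z) \o S) (h * 'X^n) = T 1 (apoly (h * 'X^n)).
  by symmetry; apply: op_pcomb => i; rewrite TE /= intS addrC.
by rewrite IH T_T intS.
Qed.

(** A power of t clears the negative exponents, and [T] discards the S- and P-parts. *)
Lemma apoly_ex v : exists (n : nat) h, T n%:Z v = apoly h.
Proof.
move: v; apply: (span_ind hbas).
- by exists 0%N, 0; rewrite op0 apoly0.
- move=> c x y [m [g gE]] [n [h hE]]; exists (m + n)%N, (c *: (g * 'X^n) + h * 'X^m).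
  rewrite apolyP !apolyMXn -gE -hE !opE !T_T PoszD.
  by rewrite (addrC n%:Z).
move=> [i|[j|[b k]]] /=; try by exists 0%N, 0; rewrite TE apoly0.
exists (absz i), 'X^(absz (i + (absz i)%:Z)); rewrite TE /apoly pcombXn.
by congr a; lia.
Qed.

(** A generator of the polynomials in K serves, since every element of K is a polynomial in K
    divided by a power of t. *)
Lemma shift_submod_principal K : shift_submod K ->
  exists g, K g /\ forall K', shift_submod K' -> K' g -> forall f, K f -> K' f.
Proof.
move=> hK; have [K0 Klin KT0 KT] := hK.
have [|c g h|h Kh|g [Kg gP]] := @poly_submodule_principal F (fun h => K (apoly h)).
- by rewrite apoly0.
- by rewrite apolyP; exact: Klin.
- by have := apolyMXn h 1; rewrite expr1 => ->; case: (KT _ Kh).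
exists (apoly g); split=> // K' hK' K'g f Kf; have [K'0 K'lin K'T0 K'T] := hK'.
have [n [h hE]] := apoly_ex f; have [Kh _] := shift_submod_T n hK Kf.
rewrite hE in Kh; have [k kE] := gP _ Kh.
have K'h : K' (apoly h).
  rewrite kE; elim/poly_ind: k {kE} => [|k c IH]; first by rewrite mul0r apoly0.
  rewrite mulrDl addrC mul_polyC apolyP; apply: K'lin => //.
  by rewrite -mulrA -commr_polyX mulrA -['X]expr1 apolyMXn; case: (K'T _ IH).
rewrite -hE in K'h; have [_] := shift_submod_T n hK' K'h.
by rewrite T_T addNr KT0.
Qed.

(** Since s_3 acts as X, the polynomials h with [pz 0 h] in I form an ideal of F[X]. *)
Lemma ideal_pz_principal I : is_ideal mul I ->
  exists h, I (pz 0 h) /\ forall J, is_ideal mul J -> J (pz 0 h) ->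
    forall g, I (pz 0 g) -> J (pz 0 g).
Proof.
move=> hI; have [|c g h|h Ih|g [Ig gP]] := @poly_submodule_principal F (fun h => I (pz 0 h)).
- by rewrite pz0; exact: ideal0.
- by rewrite pzD pzZ; exact: ideal_lin.
- by rewrite pzMX; exact: ideal_ad.
exists g; split=> // J hJ Jg h /gP [k ->].
elim/poly_ind: k => [|k c IH]; first by rewrite mul0r pz0; exact: ideal0.
rewrite mulrDl mul_polyC pzD pzZ -mulrA -commr_polyX mulrA pzMX.
by apply: idealD => //; [apply: ideal_ad|apply: idealZ].
Qed.

(** * Assembling a single generator *)

Lemma ideal_cap I J : is_ideal mul I -> is_ideal mul J -> is_ideal mul (fun v => I v /\ J v).
Proof.
move=> hI hJ; split.
- by split; exact: ideal0.
- by move=> c x y [Ix Jx] [Iy Jy]; split; exact: ideal_lin.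
- move=> x y [Iy Jy]; have hx := (ideal_ad hI x Iy, ideal_ad hJ x Jy).
  by rewrite [mul y x]mulC; case: hx => /= ? ?; split.
Qed.

Lemma principal_intro I x : is_ideal mul I -> I x ->
  (forall J, is_ideal mul J -> J x -> forall v, I v -> J v) -> is_principal mul I.
Proof. by move=> hI Ix h; exists x => v; split=> [Iv J hJ Jx|]; [exact: h Iv|exact]. Qed.

Lemma A_image_submod I : is_ideal mul I -> (forall v, I v -> wt v = 0) -> shift_submod (A_image I).
Proof.
move=> hI w0; split=> [|c f g|f [v [_ <-]]|f]; [|exact: A_image_lin|exact: T0_T0|exact: A_image_T].
by exists 0; split; [exact: ideal0|exact: op0].
Qed.

Lemma A_meet_submod I : is_ideal mul I -> (forall v, I v -> wt v = 0) -> shift_submod (A_meet I).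
Proof.
move=> hI w0; split=> [|c f g|f [v [_ <- _]]|f]; [|exact: A_meet_lin|exact: T0_T0|exact: A_meet_T].
by exists 0; split; [exact: ideal0|exact: op0|exact: op0].
Qed.

Lemma A_meet_image I f : A_meet I f -> A_image I f.
Proof. by case=> v [Iv <- _]; exists v. Qed.

(* Two nested ideals with the same image in [A] agree modulo [P] as soon as their
   intersections with [A] do. *)
Lemma ideal_mod_piP I J v : is_ideal mul I -> is_ideal mul J ->
  (forall u, I u -> wt u = 0) -> (forall u, J u -> I u) ->
  (forall f, A_image I f -> A_image J f) -> (forall f, A_meet I f -> A_meet J f) ->
  I v -> exists w, J w /\ piP (v - w) = v - w.
Proof.
move=> hI hJ w0 JI IAJ INJ Iv.
have [w [Jw wE]] : A_image J (T 0 v) by apply: IAJ; exists v.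
move uE : (v - w) => u; have Iu : I u by rewrite -uE; apply: idealB => //; exact: JI.
have Tu l : T l u = 0 by apply: T_vanish; rewrite -uE !opE wE subrr.
(* The factor 3/2 - a_0 turns the S-part of [u] into an A-part and leaves no S-part. *)
have [z [Jz zE z0]] : A_meet J (iot u).
  apply: INJ; exists (- ad (a 0) u + (3%:R / 2%:R) *: u); split.
  - rewrite -scaleN1r; apply: ideal_lin => //; last exact: idealZ.
    exact: ideal_ad.
  - by rewrite !opE T_ad_a ?w0 // !Tu T0_iot; vring.
  - by rewrite !opE piS_ad_a oppr0 Tu op0; vring.
have wz : wt z = 0 by exact/w0/JI.
(* Multiplying by a_0 takes the A-part of [z] back to S; -4/3 inverts the -3/4 of [kap_iot]. *)
move yE : (- (4%:R / 3%:R) *: (ad (a 0) z - 2^-1 *: z)) => y.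
have Jy : J y by rewrite -yE; exact: (idealZ hJ _ (idealB hJ (ideal_ad hJ _ Jz) (idealZ hJ _ Jz))).
exists (w + y); split; first exact: idealD.
have -> : v - (w + y) = u - y by rewrite -uE; vring.
apply: piP_P.
  by rewrite opD opN Tu -yE !opE T_ad_a // iot_vanish // op0; vring.
rewrite opD opN -yE !opE piS_ad_a z0 oppr0 zE kap_iot.
by vring.
Qed.

Lemma ideal_principal I : is_ideal mul I -> is_principal mul I.
Proof.
move=> hI; have [[v [Iv v0]]|nwt] := classic (exists v, I v /\ wt v != 0).
  by apply: (principal_intro hI Iv) => J hJ Jv u _; exact: ideal_full Jv v0.
have w0 v : I v -> wt v = 0.
  by move=> Iv; apply/eqP/negPn/negP => v0; apply: nwt; exists v.
have [g [IAg gP]] := shift_submod_principal (A_image_submod hI w0).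
have [h [Ih hP]] := ideal_pz_principal hI.
have [x [Ix xg xN]] : exists x, [/\ I x, T 0 x = g & A_meet I g -> piS x = 0].
  have [[x [Ix xg x0]]|n] := classic (A_meet I g); first by exists x.
  by have [x [Ix xg]] := IAg; exists x.
have prE := piP_proj (w0 _ Ix).
(* Exchanges [proj x] for the generator of the P-part, leaving x unchanged modulo P; 1/4 compensates
   for [proj] being 4 on its image. *)
move yE : (x - 4%:R^-1 *: proj x + 4%:R^-1 *: pz 0 h) => y.
have Iy : I y.
  rewrite -yE; apply: (idealD hI); last exact: (idealZ hI _ Ih).
  exact: (idealB hI Ix (idealZ hI _ (ideal_proj hI Ix))).
have yg : T 0 y = g by rewrite -yE -prE -piP_pz !opE !T_piP xg; vring.
have yS : piS y = piS x by rewrite -yE -prE -piP_pz !opE !piS_piP; vring.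
have yP : proj y = pz 0 h.
  rewrite -yE -[- (_ *: proj x)]scaleNr !(projB, projZ) proj_proj ?w0 // proj_pz.
  by vring.
apply: (principal_intro hI Iy) => J0 hJ0 J0y v Iv.
(* Intersecting with I makes the two ideals nested. *)
pose J v := I v /\ J0 v; have hJ : is_ideal mul J by exact: ideal_cap.
suff [] : J v by [].
have Jy : J y by [].
have wJ u : J u -> wt u = 0 by case=> /w0.
have IAJ f : A_image I f -> A_image J f.
  by move=> If; apply: (gP _ (A_image_submod hJ wJ) _ f If); exists y.
have INJ f : A_meet I f -> A_meet J f.
  (* If g is in [A_meet I], then g generates [A_meet I], and [y] has no S-part, so g is in
     [A_meet J]. *)
  have [INg|nINg] := classic (A_meet I g) => INf.
    by apply: (gP _ (A_meet_submod hJ wJ) _ f (A_meet_image INf)); exists y; rewrite yS xN.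
  (* Otherwise K = F g + [A_meet J] is an ideal of F[t,1/t], because (t - 1) g is in [A_meet J], and
     it contains the image of I. If f = c g + n is in [A_meet I], then c = 0, as else g would be
     there too. *)
  pose K f := T 0 f = f /\ exists c, A_meet J (f - c *: g).
  have [N0 Nlin NT0 NT] := A_meet_submod hJ wJ.
  have gT0 : T 0 g = g by rewrite -yg T0_T0.
  have dg : A_meet J (T 1 g - g) by apply: A_meet_Tsub => //; exact: IAJ.
  have dg' : A_meet J (T (-1) g - g).
    have -> : T (-1) g - g = (-1) *: T (-1) (T 1 g - g) + 0.
      by rewrite !opE T_T addNr gT0; vring.
    by apply: Nlin => //; case: (NT _ dg).
  have hK : shift_submod K.
    split.
    - by split; [exact: op0|exists 0; rewrite scale0r subr0].
    - move=> c f1 f2 [e1 [c1 h1]] [e2 [c2 h2]]; split; first by rewrite !opE e1 e2.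
      exists (c * c1 + c2).
      have -> : c *: f1 + f2 - (c * c1 + c2) *: g = c *: (f1 - c1 *: g) + (f2 - c2 *: g) by vring.
      exact: Nlin.
    - by move=> ? [].
    - move=> f1 [e1 [c1 /NT[h1 h2]]]; split; (split; first by rewrite T_T add0r); exists c1.
        have -> : T 1 f1 - c1 *: g = c1 *: (T 1 g - g) + T 1 (f1 - c1 *: g) by rewrite !opE; vring.
        exact: Nlin.
      have -> : T (-1) f1 - c1 *: g = c1 *: (T (-1) g - g) + T (-1) (f1 - c1 *: g).
        by rewrite !opE; vring.
      exact: Nlin.
  have Kg : K g by split=> //; exists 1; rewrite scale1r subrr.
  have [_ [c INc]] := gP K hK Kg f (A_meet_image INf).
  have [c0|c0] := eqVneq c 0; first by rewrite c0 scale0r subr0 in INc.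
  case: nINg; have [NI0 NIlin _ _] := A_meet_submod hI w0.
  have INc' : A_meet I (f - c *: g) by case: INc => u [[Iu _] u1 u2]; exists u.
  have -> : g = - c^-1 *: (f - c *: g) + (c^-1 *: f + 0).
    by rewrite scalerBr scalerA !mulNr mulVf // addr0 scaleNr scaleNr; vring.
  by apply/NIlin/NIlin.
have [w [Jw pE]] : exists w, J w /\ piP (v - w) = v - w.
  by apply: (ideal_mod_piP hI hJ w0 _ IAJ INJ Iv) => u [].
(* The remainder lies in both I and P, so [ideal_pz_split] treats its two summands separately. *)
have [h1 [h2 hE]] := piP_pz_ex (v - w).
have Jh : J (pz 0 h) by rewrite -yP; exact: (ideal_proj hJ Jy).
have [Ih1 Ih2] : I (pz 0 h1) /\ I (pz 0 h2).
  apply: (ideal_pz_split hI); rewrite -hE pE; apply: (idealB hI Iv).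
  by case: Jw.
have -> : v = w + (pz 0 h1 + pz 1 h2) by rewrite -hE pE; vring.
apply: (idealD hJ Jw); apply: (idealD hJ); first exact: (hP _ hJ Jh _ Ih1).
exact: (ideal_pz hJ 1 (hP _ hJ Jh _ Ih2)).
Qed.

End Algebra.

Unset Implicit Arguments.
Set Strict Implicit.

Theorem theorem1p5
  (F : fieldType) (hF2 : 2%N \notin [pchar F]) (hF3 : 3%N \notin [pchar F])
  (V : lmodType F) (mul : V -> V -> V)
  (mulC : forall x y, mul x y = mul y x)
  (mul_linl : forall (c : F) x y w, mul (c *: x + y) w = c *: mul x w + mul y w)
  (a : int -> V) (s : nat -> V) (p : 'Z_3 -> nat -> V)
  (hs0 : s 0%N = 0)
  (hp3N : forall r j, ~~ ((0 < j)%N && (3 %| j)%N) -> p r j = 0)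
  (hp0 : forall j, p 0 j = - p 1 j - p 2%:R j)
  (hbas : is_basis (hbasis a s p))
  (H1 : forall i i' : int,
     mul (a i) (a i') = 2^-1 *: (a i + a i') + s (absz (i - i'))
                        + zz p (ibar i) (absz (i - i')))
  (H2 : forall (i : int) (j : nat), (0 < j)%N ->
     mul (a i) (s j) = - (3%:R / 4%:R) *: a i
                       + (3%:R / 8%:R) *: (a (i - j%:Z) + a (i + j%:Z))
                       + (3%:R / 2%:R) *: s j - zz p (ibar i) j)
  (H3 : forall (i : int) (r : 'Z_3) (k : nat), (0 < k)%N -> (3 %| k)%N ->
     mul (a i) (p r k) = (3%:R / 2%:R) *: p r k - p (- (ibar i + r)) k)
  (H4 : forall j l : nat, (0 < j)%N -> (0 < l)%N ->
     mul (s j) (s l) = (3%:R / 4%:R) *: (s j + s l)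
       - (3%:R / 8%:R) *: (s (absz (j%:Z - l%:Z)) + s (j + l)%N))
  (H5 : forall (j : nat) (r : 'Z_3) (k : nat), (0 < j)%N -> (0 < k)%N -> (3 %| k)%N ->
     mul (s j) (p r k) = (3%:R / 4%:R) *: (p r j + p r k)
       - (3%:R / 8%:R) *: (p r (absz (j%:Z - k%:Z)) + p r (j + k)%N))
  (H6 : forall (r t : 'Z_3) (h k : nat),
     (0 < h)%N -> (3 %| h)%N -> (0 < k)%N -> (3 %| k)%N ->
     mul (p r h) (p t k) =
       4%:R^-1 *: (zz p (- (r + t)) h + zz p (- (r + t)) k)
       - 8%:R^-1 *: (zz p (- (r + t)) (absz (h%:Z - k%:Z))
                     + zz p (- (r + t)) (h + k)%N)) :
  forall I : V -> Prop, is_ideal mul I -> is_principal mul I.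
Proof.
exact: (ideal_principal hF2 hF3 mulC mul_linl hs0 hp3N hp0 hbas H1 H2 H3 H4 H5).
Qed.
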